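(* Let $k \ge 2$, $t \ge 1$ and $n \ge 1$ be integers, let $c_1, \dots, c_{k-1}$ be positive integers, and let $b$ be a positive integer. Let $\mathcal{E}(-b)$ denote the equation \[ c_1x_1+c_2x_2+\dots+c_{k-1}x_{k-1} = x_k - b. \] Let $s = \sum_{i=1}^{k-1} c_i - 1$. If $s \mid b$ and there is a $t$-coloring of the interval $[1,n]$ which satisfies the excellence condition (for $c_1,\dots,c_{k-1}$), then \[ r(\mathcal{E}(-b);t) \ge \left(\frac{b}{s}+1\right)\cdot n + 1. \]
   Context: For a positive integer $n$, $[1,n]=\{1,2,\dots,n\}$; a $t$-coloring of $[1,n]$ is a map from $[1,n]$ to a set of $t$ colors. A monochromatic (''mono'') solution to an equation in the variables $x_1,\dots,x_k$ is a $k$-tuple $(x_1,\dots,x_k)$ of elements of the interval, not necessarily distinct, that satisfies the equation and whose entries all have the same color. For a linear equation $\mathcal{E}$, the $t$-color Rado number $r(\mathcal{E};t)$ is the least positive integer $r$, if it exists, such that every $t$-coloring of $[1,r]$ admits a monochromatic solution to $\mathcal{E}$; if no such integer exists we set $r(\mathcal{E};t)=\infty$. Excellence condition: given positive integers $c_1,\dots,c_{k-1}$ and $s=\sum_{i=1}^{k-1}c_i-1$, a coloring of $[1,n]$ satisfies the excellence condition if, for every integer $j$ with $0\le j\le s$, it does not contain any monochromatic solution to $c_1x_1+c_2x_2+\dots+c_{k-1}x_{k-1}+j=x_k$ (with all $x_i\in[1,n]$). $s \mid b$ means $b = sq$ for some integer $q$; since $b>0$ this forces $s \ge 1$. *)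

(* Defs.v *)
From mathcomp Require Import all_boot all_order all_algebra.
From mathcomp Require Import boolp constructive_ereal.

Set Implicit Arguments.
Unset Strict Implicit.
Unset Printing Implicit Defensive.

Import Order.TTheory GRing.Theory Num.Theory.
Local Open Scope ring_scope.

Definition interval1 (n : nat) : Type := {x : nat | (1 <= x <= n)%N}.

Definition coloring (t n : nat) : Type := interval1 n -> 'I_t.

(* An equation in k integer unknowns, as the predicate "x satisfies it". *)
Definition equation (k : nat) : Type := ('I_k -> int) -> Prop.

Definition mono_solution (k t n : nat) (E : equation k) (chi : coloring t n)
    (x : 'I_k -> interval1 n) : Prop :=
  E (fun i => (val (x i))%:Z) /\ (forall i j, chi (x i) = chi (x j)).

Definition forces_mono (k : nat) (E : equation k) (t r : nat) : Prop :=
  (0 < r)%N /\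
  forall chi : coloring t r, exists x : 'I_k -> interval1 r,
    mono_solution E chi x.

Definition rado (k : nat) (E : equation k) (t : nat) : \bar rat :=
  match pselect (exists r, `[< forces_mono E t r >]) with
  | left r_ex => ((ex_minn r_ex)%:R)%:E
  | right _ => +oo%E
  end.

(* The unknowns x_1, ..., x_k are indexed from 0: with m = k - 1 the first m
   of them carry the coefficients c, and [x ord_max] is x_k. *)
Definition lhs (m : nat) (c : 'I_m -> nat) (x : 'I_m.+1 -> int) : int :=
  \sum_(i < m) (c i)%:Z * x (widen_ord (leqnSn m) i).

Definition shifted_eqn (m : nat) (c : 'I_m -> nat) (a : int) :
    equation m.+1 :=
  fun x => lhs c x = x ord_max + a.

Definition coef_excess (m : nat) (c : 'I_m -> nat) : int :=
  (\sum_(i < m) (c i)%:Z) - 1.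

Definition excellent (m : nat) (c : 'I_m -> nat) (t n : nat)
    (chi : coloring t n) : Prop :=
  forall j : int, 0 <= j <= coef_excess c ->
    ~ exists x : 'I_m.+1 -> interval1 n,
        mono_solution (fun y => lhs c y + j = y ord_max) chi x.

(* Main.v *)
Require Import Defs.
From mathcomp Require Import all_boot all_order all_algebra.
From mathcomp Require Import boolp constructive_ereal.
From mathcomp Require Import zify.

(** The coloring of [1, n] is blown up by the factor q + 1, where b = s q:
    [1, (q + 1) n] is cut into n consecutive blocks of length q + 1, and all of
    block y gets the color of y.  Suppose that the blown-up coloring had a
    monochromatic solution x of c_1 x_1 + ... + c_(k-1) x_(k-1) + s q = x_k.
    Let x_i lie in block y_i, so that x_i = (q + 1) y_i - r_i with
    0 <= r_i <= q, and put j = y_k - sum_i c_i y_i.  Substituting,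
      (q + 1) j = s q + r_k - sum_i c_i r_i,
    and since the c_i add up to s + 1, the right-hand side is between
    s q - (s + 1) q = - q and s q + q = (s + 1) q.  Hence -1 < j < s + 1, that
    is 0 <= j <= s, and y is a monochromatic solution, for the original
    coloring, of one of the equations excluded by the excellence condition
    ([blowup_no_mono_solution]).  The same holds for the blow-up restricted to
    [1, r] with r <= (q + 1) n, so no such r forces a monochromatic solution. *)

Set Implicit Arguments.
Unset Strict Implicit.
Unset Printing Implicit Defensive.

Import Order.TTheory GRing.Theory Num.Theory.
Local Open Scope ring_scope.

Lemma lhsZB (m : nat) (c : 'I_m -> nat) (a : int) (y r : 'I_m.+1 -> int) :
  lhs c (fun i => a * y i - r i) = a * lhs c y - lhs c r.
Proof.
rewrite /lhs mulr_sumr -sumrB; apply: eq_bigr => i _.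
by rewrite mulrBr mulrCA.
Qed.

Lemma lhs_ge0 (m : nat) (c : 'I_m -> nat) (r : 'I_m.+1 -> int) :
  (forall i, 0 <= r i) -> 0 <= lhs c r.
Proof. by move=> r_ge0; apply: sumr_ge0 => i _; rewrite mulr_ge0. Qed.

Lemma lhs_le (m : nat) (c : 'I_m -> nat) (q : int) (r : 'I_m.+1 -> int) :
  (forall i, r i <= q) -> lhs c r <= (coef_excess c + 1) * q.
Proof.
move=> r_le; rewrite /coef_excess subrK mulr_suml.
by apply: ler_sum => i _; rewrite ler_wpM2l.
Qed.

(** The extreme cases are r_k = 0 with all other offsets equal to q, and
    r_k = q with all other offsets equal to 0. *)
Lemma quotient_excess_bounds (m : nat) (c : 'I_m -> nat) (q : nat)
    (y r : 'I_m.+1 -> int) :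
  0 <= coef_excess c -> (forall i, 0 <= r i <= q%:Z) ->
  shifted_eqn c (- (coef_excess c * q%:Z)) (fun i => q.+1%:Z * y i - r i) ->
  0 <= y ord_max - lhs c y <= coef_excess c.
Proof.
move=> s_ge0 r_bnd; rewrite /shifted_eqn lhsZB => eq_x.
have R_ge0 : 0 <= lhs c r by apply: lhs_ge0 => i; case/andP: (r_bnd i).
have R_le : lhs c r <= (coef_excess c + 1) * q%:Z.
  by apply: lhs_le => i; case/andP: (r_bnd i).
have /andP[rk_ge0 rk_le] := r_bnd ord_max.
move: (lhs c r) (lhs c y) (y ord_max) (r ord_max) (coef_excess c) s_ge0
  eq_x R_ge0 R_le rk_ge0 rk_le => R Y yk rk s s_ge0 eq_x R_ge0 R_le rk_ge0
  rk_le.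
have def_j : q.+1%:Z * (yk - Y) = s * q%:Z + rk - R.
  by rewrite mulrBr; lia.
(* With j = yk - Y an integer, -1 < j < s + 1 suffices; multiplied by q + 1,
   these bounds follow from the range [- q, (s + 1) q] of the right-hand side
   of def_j. *)
have j_gtN1 : q.+1%:Z * (-1) < q.+1%:Z * (yk - Y) by rewrite def_j; lia.
have j_lt : q.+1%:Z * (yk - Y) < q.+1%:Z * (s + 1) by rewrite def_j; lia.
rewrite !ltr_pM2l // in j_gtN1 j_lt.
by apply/andP; split; lia.
Qed.

Lemma block_subproof (n r q : nat) (r_le : (r <= q.+1 * n)%N)
    (x : interval1 r) : (1 <= ((val x).-1 %/ q.+1).+1 <= n)%N.
Proof.
case: x => x /= /andP[x_ge1 x_le].
by rewrite ltn_divLR // mulnC; lia.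
Qed.

Definition block (n r q : nat) (r_le : (r <= q.+1 * n)%N) (x : interval1 r) :
  interval1 n :=
  exist (fun y : nat => (1 <= y <= n)%N) _ (block_subproof r_le x).

Definition blowup (t n r q : nat) (r_le : (r <= q.+1 * n)%N)
  (chi : coloring t n) : coloring t r := fun x => chi (block r_le x).

Lemma block_offset (n r q : nat) (r_le : (r <= q.+1 * n)%N) (x : interval1 r) :
  0 <= q.+1%:Z * (val (block r_le x))%:Z - (val x)%:Z <= q%:Z.
Proof.
case: x => x /= /andP[x_ge1 _].
have := divn_eq x.-1 q.+1; have := ltn_pmod x.-1 (ltn0Sn q).
by move: (_ %/ _)%N (_ %% _)%N => d e; nia.
Qed.

(** Passing from the points [x i] to their blocks turns a monochromatic
    solution for the blow-up into one that excellence of [chi] rules out. *)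
Lemma blowup_no_mono_solution (m t n r q : nat) (c : 'I_m -> nat)
    (r_le : (r <= q.+1 * n)%N) (chi : coloring t n)
    (x : 'I_m.+1 -> interval1 r) :
  0 <= coef_excess c -> excellent c chi ->
  ~ mono_solution (shifted_eqn c (- (coef_excess c * q%:Z)))
      (blowup r_le chi) x.
Proof.
move=> s_ge0 chi_exc [eq_x mono_x].
pose y i : int := (val (block r_le (x i)))%:Z.
have bnd : 0 <= y ord_max - lhs c y <= coef_excess c.
  apply: (@quotient_excess_bounds _ _ q _
            (fun i => q.+1%:Z * y i - (val (x i))%:Z)) => //.
    by move=> i; apply: block_offset.
  by under [X in shifted_eqn _ _ X]eq_fun => i do rewrite subKr.
apply: (chi_exc _ bnd); exists (fun i => block r_le (x i)).
by split; [rewrite -/y addrC subrK | apply: mono_x].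
Qed.

Lemma coef_excess_ge0 (m : nat) (c : 'I_m -> nat) :
  (0 < m)%N -> (forall i, (0 < c i)%N) -> 0 <= coef_excess c.
Proof.
case: m c => // m c _ c_gt0; rewrite /coef_excess subr_ge0 big_ord_recl.
rewrite -[1]addr0 lerD //; first by rewrite lez_nat c_gt0.
exact: sumr_ge0.
Qed.

Lemma rado_ge (k : nat) (E : equation k) (t : nat) (N : nat) :
  (forall r, forces_mono E t r -> (N <= r)%N) ->
  ((N%:R : rat)%:E <= rado E t)%E.
Proof.
move=> N_le; rewrite /rado; case: pselect => [r_ex|_]; last exact: leey.
by rewrite lee_fin ler_nat; case: ex_minnP => r /asboolP /N_le.
Qed.

Theorem theorem4 (k t n b : nat) (c : 'I_k.-1 -> nat)
    (k_ge2 : (2 <= k)%N) (t_ge1 : (1 <= t)%N) (n_ge1 : (1 <= n)%N)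
    (c_gt0 : forall i, (0 < c i)%N) (b_gt0 : (0 < b)%N)
    (s_dvd_b : (coef_excess c %| b%:Z)%Z)
    (chi_ex : exists chi : coloring t n, excellent c chi) :
  ((((b%:Z)%:~R / (coef_excess c)%:~R + 1) * n%:R + 1)%:E
     <= rado (shifted_eqn c (- b%:Z)) t)%E.
Proof.
have [chi chi_exc] := chi_ex.
have s_ge0 : 0 <= coef_excess c by apply: coef_excess_ge0 => //; lia.
have [q def_b] : exists q : nat, b%:Z = coef_excess c * q%:Z.
  have /dvdzP[[q|q] def_b] := s_dvd_b; first by exists q; rewrite mulrC.
  by exfalso; move: def_b; nia.
have s_neq0 : (coef_excess c)%:~R != 0 :> rat.
  by rewrite intr_eq0; apply/eqP => s0; move: def_b; rewrite s0 mul0r; lia.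
have -> : ((b%:Z)%:~R / (coef_excess c)%:~R + 1) * n%:R + 1
          = (q.+1 * n).+1%:R :> rat.
  by rewrite def_b intrM mulrAC mulfV // mul1r -pmulrn natr1 -natrM natr1.
apply: rado_ge => r [_ r_forces]; rewrite ltnNge; apply/negP => r_le.
have [x] := r_forces (blowup r_le chi).
by rewrite def_b; apply: blowup_no_mono_solution.
Qed.
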